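(* Let $L_n$ be the path graph on $n$ vertices and let $I(L_n^2)$ be the edge ideal of the square of $L_n$. Then $$\mathrm{v}(I(L_n^2))=\begin{cases}\lfloor \frac n6\rfloor, & \text{if } n\equiv 0,1 \pmod 6,\\ \lfloor \frac n6\rfloor+1, & \text{otherwise.}\end{cases}$$
   Context: The square $G^2$ of a simple graph $G$ is the graph on the same vertex set in which two distinct vertices are adjacent iff their distance in $G$ is at most $2$. For a simple graph $H$ with vertices $x_1,\dots,x_n$, its edge ideal is $I(H)=(x_ix_j : \{x_i,x_j\}\in E(H))\subseteq S=K[x_1,\dots,x_n]$, $K$ a field. The v-number: for a graded ideal $I$ of the standard graded polynomial ring $S$ with $\mathfrak m$ the ideal generated by all variables, $\mathrm{v}(I)=\min\{d\ge 1 : \text{there exist } f\in S_d \text{ and } \mathfrak p\in \mathrm{Ass}(I) \text{ with } (I:f)=\mathfrak p\}$ if $I\subsetneq\mathfrak m$, and $\mathrm{v}(\mathfrak m)=0$. Here $S_d$ is the degree-$d$ component and $\mathrm{Ass}(I)$ is the set of associated primes of $S/I$.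
   Formalization: The theorem is stated for n ≥ 2; at n = 1 the edge ideal is 0, strictly inside (x_1), and since the minimum is over d ≥ 1 its v-number is 1 (take f = x_1, prime ideal 0), whereas the formula gives 0. *)

(* Defs.v *)
From HB Require Import structures.
From mathcomp Require Import all_boot all_order all_algebra.
From mathcomp Require Import mpoly.

Set Implicit Arguments.
Unset Strict Implicit.
Unset Printing Implicit Defensive.

Import GRing.Theory.
Local Open Scope ring_scope.

Record sgraph (T : finType) := SGraph {
  adj :> rel T;
  adj_sym : ssrbool.symmetric adj;
  adj_irr : irreflexive adj }.

Section Graphs.
Variable T : finType.
Implicit Type G : sgraph T.

(* The distance is at most d exactly when some walk has length at most d.
   For adjacent x and y the tuple is the walk without its origin x, so its
   size is the number of edges. *)
Definition dist_le G (d : nat) : rel T := fun x y =>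
  [exists k : 'I_d.+1, exists p : k.-tuple T, path G x p && (last x p == y)].

Lemma dist_le_sym G d : ssrbool.symmetric (dist_le G d).
Proof.
suff H x y : dist_le G d x y -> dist_le G d y x by move=> x y; apply/idP/idP; exact: H.
case/existsP=> k /existsP[p /andP[pth /eqP ly]].
apply/existsP; exists k; apply/existsP.
have sz : size (rev (belast x p)) == k by rewrite size_rev size_belast size_tuple.
exists (Tuple sz) => /=; rewrite -ly rev_path.
have -> : path (fun z : T => G^~ z) x p = path G x p.
  by apply: eq_path => u v; rewrite adj_sym.
rewrite pth /=.
case: {pth ly sz} (tval p) => [|a s] /=; first by rewrite eqxx.
by rewrite rev_cons last_rcons.
Qed.

Definition square_adj G : rel T := fun x y => (x != y) && dist_le G 2 x y.

Lemma square_sym G : ssrbool.symmetric (square_adj G).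
Proof. by move=> x y; rewrite /square_adj eq_sym dist_le_sym. Qed.

Lemma square_irr G : irreflexive (square_adj G).
Proof. by move=> x; rewrite /square_adj eqxx. Qed.

Definition square G : sgraph T := SGraph (square_sym G) (@square_irr G).

End Graphs.

Definition path_adj (n : nat) : rel 'I_n := fun i j =>
  (i.+1 == j :> nat) || (j.+1 == i :> nat).

Lemma path_adj_sym n : ssrbool.symmetric (@path_adj n).
Proof. by move=> i j; rewrite /path_adj orbC. Qed.

Lemma path_adj_irr n : irreflexive (@path_adj n).
Proof. by move=> i; rewrite /path_adj orbb gtn_eqF. Qed.

Definition path_graph (n : nat) : sgraph 'I_n :=
  SGraph (@path_adj_sym n) (@path_adj_irr n).

(* Ideals are Prop-valued: membership in a generated ideal and in a colon
   ideal is not given by a boolean test. *)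
Section Ideals.
Variable R : comNzRingType.
Implicit Types (I J p : R -> Prop) (f g : R).

Definition is_ideal I : Prop :=
  [/\ I 0, forall f g, I f -> I g -> I (f + g) & forall a f, I f -> I (a * f)].

Definition ideal_gen (A : R -> Prop) : R -> Prop := fun f =>
  exists (m : nat) (a g : 'I_m -> R),
    (forall i, A (g i)) /\ f = \sum_(i < m) a i * g i.

Definition ideal_eq I J : Prop := forall f, I f <-> J f.

Definition ideal_proper_sub I J : Prop :=
  (forall f, I f -> J f) /\ ~ (forall f, J f -> I f).

Definition is_prime_ideal p : Prop :=
  [/\ is_ideal p, ~ p 1 & forall f g, p (f * g) -> p f \/ p g].

Definition colon I f : R -> Prop := fun g => I (g * f).

(* The annihilator of the class of f in R/I is (I : f). *)
Definition is_assoc_prime I p : Prop :=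
  is_prime_ideal p /\ exists f, ideal_eq p (colon I f).

End Ideals.

Section VNumber.
Variables (K : fieldType) (n : nat).
Local Notation S := {mpoly K[n]}.

Definition maximal_graded_ideal : S -> Prop :=
  ideal_gen (fun f : S => exists i : 'I_n, f = 'X_i).

Definition edge_ideal (G : sgraph 'I_n) : S -> Prop :=
  ideal_gen (fun f : S => exists i j : 'I_n, adj G i j /\ f = 'X_i * 'X_j).

Definition vnumber_at (I : S -> Prop) (d : nat) : Prop :=
  exists (f : S) (p : S -> Prop),
    [/\ f \is d.-homog, is_assoc_prime I p & ideal_eq (colon I f) p].

(* [is_vnumber I v] reads v(I) = v; being a relation, it also asserts that the
   minimum is attained.  The degree d = 0 is excluded from the minimum. *)
Definition is_vnumber (I : S -> Prop) (v : nat) : Prop :=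
  (ideal_eq I maximal_graded_ideal /\ v = 0%N) \/
  (ideal_proper_sub I maximal_graded_ideal /\
   [/\ (1 <= v)%N, vnumber_at I v
     & forall d : nat, (1 <= d)%N -> vnumber_at I d -> (v <= d)%N]).

End VNumber.

(* Main.v *)
Require Import Defs.
From mathcomp Require Import all_boot all_order all_algebra.
From mathcomp Require Import mpoly zify.

(** The theorem splits into an algebraic part, valid for every graph [G], and a
    count on the square of a path.

    Algebra: if the v-number of [I(G)] is witnessed in degree [d], then some
    stable set [A] with at most [d] vertices has a neighbourhood [N(A)] meeting
    every edge ([vnumber_at_stable]); conversely, every stable [A] such that
    [N(A)] meets every edge gives a witness of degree [#|A|]
    ([stable_vnumber_at]).  For the first claim, let [(I : f) = p] be prime and
    take a monomial [m] of [f] outside [I], with support [A].  For each edge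
    [ij], one of [X_i], [X_j] is in [p], since their product is; and [X_i f] in
    [I] forces the monomial [X_i m] to be divisible by an edge, hence [i] to be
    in [N(A)].  For the second, take for [f] the product of the variables in
    [A]: then [(I : f)] is generated by the variables in [N(A)].

    Count: in the square of the path on [n] vertices, a stable set has at most
    [(n + 2) / 3] vertices and a vertex has at most 4 neighbours.  As the
    complement of [N(A)] is stable, [n <= (n + 2) / 3 + 4 #|A|], which amounts
    to [n <= 6 #|A| + 1].  Equality [#|A| = ceil ((n - 1) / 6)] is reached by a
    suitable residue class modulo 6 ([square_path_witness]), and this ceiling
    is the value in the theorem. *)

Set Implicit Arguments.
Unset Strict Implicit.
Unset Printing Implicit Defensive.

Import GRing.Theory.

(** * Ideals given by generators *)

Section GeneratedIdeals.
Variable R : comNzRingType.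
Local Open Scope ring_scope.
Implicit Types A J : R -> Prop.

Lemma ideal_gen_ideal A : is_ideal (ideal_gen A).
Proof.
split=> [|f g [m [a [u [Au ->]]]] [k [b [v [Av ->]]]]|b f [m [a [u [Au ->]]]]].
- exists 0%N, (fun _ => 0), (fun _ => 0); split=> [[//]|].
  by rewrite big_ord0.
- exists (m + k)%N, (fun i => match split i with inl j => a j | inr j => b j end),
    (fun i => match split i with inl j => u j | inr j => v j end).
  split=> [i|]; first by case: (split i).
  rewrite big_split_ord; congr (_ + _); apply: eq_bigr => i _.
    by rewrite -[lshift _ _]/(unsplit (inl i)) unsplitK.
  by rewrite -[rshift _ _]/(unsplit (inr i)) unsplitK.
- exists m, (fun i => b * a i), u; split=> //.
  by rewrite mulr_sumr; apply: eq_bigr => i _; rewrite mulrA.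
Qed.

Lemma ideal_gen_mem A f : A f -> ideal_gen A f.
Proof.
move=> Af; exists 1%N, (fun _ => 1), (fun _ => f); split=> //.
by rewrite big_ord1 mul1r.
Qed.

Lemma ideal_sum J (T : eqType) (r : seq T) (F : T -> R) :
  is_ideal J -> (forall x, x \in r -> J (F x)) -> J (\sum_(x <- r) F x).
Proof.
case=> J0 JD _ JF; rewrite big_seq.
by apply: (big_ind J) => // x xr; apply: JF.
Qed.

Lemma ideal_gen_sub A J :
  is_ideal J -> (forall f, A f -> J f) -> forall f, ideal_gen A f -> J f.
Proof.
move=> iJ AJ f [m [a [g [Ag ->]]]]; apply: ideal_sum => // i _.
by case: iJ => _ _; apply; apply: AJ.
Qed.

End GeneratedIdeals.

(** * Ideals of polynomials described by their monomials *)

Section MonomialIdeals.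
Variables (K : fieldType) (n : nat).
Local Open Scope ring_scope.
Implicit Types (f g : {mpoly K[n]}) (m : 'X_{1..n}) (C : {set 'I_n}).

(** The support of a product consists of products of monomials, so a condition
    inherited by multiples cuts out an ideal. *)
Lemma supp_ideal (P : pred 'X_{1..n}) :
    (forall m m', P m -> P (m' + m)%MM) ->
  is_ideal (fun f => {in msupp f, forall m, P m}).
Proof.
move=> Pup; split=> [m|f g Pf Pg m /msuppD_le|a f Pf m /msuppM_le].
- by rewrite msupp0.
- by rewrite mem_cat => /orP[/Pf|/Pg].
- by case/allpairsP=> -[m1 m2] /= [_ /Pf Pm2 ->]; apply: Pup.
Qed.

Definition mnm_supp m : {set 'I_n} := [set i | 0 < m i]%N.

Lemma mnm_suppD m m' : mnm_supp (m + m')%MM = mnm_supp m :|: mnm_supp m'.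
Proof. by apply/setP=> i; rewrite !inE mnmDE addn_gt0. Qed.

Lemma mnm_supp1 i : mnm_supp U_(i)%MM = [set i].
Proof. by apply/setP=> j; rewrite !inE mnm1E lt0b eq_sym. Qed.

Lemma card_mnm_supp m : (#|mnm_supp m| <= mdeg m)%N.
Proof.
rewrite mdegE -sum1_card [leqLHS](eq_bigl (fun i => 0 < m i)%N); last first.
  by move=> i; rewrite inE.
rewrite big_mkcond /=; apply: leq_sum => i _.
by case: ifP.
Qed.

Definition set_mnm C : 'X_{1..n} := [multinom nat_of_bool (i \in C) | i < n].

Lemma mnm_supp_set C : mnm_supp (set_mnm C) = C.
Proof. by apply/setP=> i; rewrite !inE mnmE lt0b. Qed.

Lemma mdeg_set_mnm C : mdeg (set_mnm C) = #|C|.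
Proof.
rewrite mdegE -sum1_card [RHS]big_mkcond; apply: eq_bigr => i _.
by rewrite mnmE; case: (i \in C).
Qed.

(** The images of the variables under the retraction of the polynomial ring
    onto the subring in the variables of [C]. *)
Definition kill_outside C : n.-tuple {mpoly K[n]} :=
  [tuple if i \in C then 'X_i else 0 | i < n].

Lemma kill_outside_mnm C m :
  'X_[m] \mPo kill_outside C = if mnm_supp m \subset C then 'X_[m] else 0.
Proof.
rewrite comp_mpolyX; case: ifPn => [/subsetP mC|/subsetPn[i]].
  rewrite [RHS]mpolyXE_id; apply: eq_bigr => i _; rewrite tnth_mktuple.
  case: ifPn => // iC; have -> : m i = 0%N; last by rewrite !expr0.
  by apply/eqP; rewrite -leqn0 leqNgt; apply: contra iC => ?; apply: mC; rewrite inE.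
rewrite inE => mi iC; rewrite (bigD1 i) //= tnth_mktuple (negPf iC).
by rewrite expr0n eqn0Ngt mi mul0r.
Qed.

(** Substitution fixes the monomials in the variables of [C] and kills the
    others, so no cancellation occurs. *)
Lemma kill_outside_eq0 C g :
  g \mPo kill_outside C = 0 <->
  {in msupp g, forall m, ~~ (mnm_supp m \subset C)}.
Proof.
rewrite comp_mpolyEX; split=> [g0 m mg|gC]; last first.
  rewrite big_seq big1 // => m /gC mC.
  by rewrite kill_outside_mnm (negPf mC) scaler0.
apply/negP=> mC; move/(congr1 (mcoeff m)): g0.
rewrite raddf_sum mcoeff0 (bigD1_seq m) ?msupp_uniq //= big1 ?addr0.
  move/eqP; rewrite kill_outside_mnm mC mcoeffZ mcoeffX eqxx mulr1.
  by rewrite mcoeff_eq0 mg.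
move=> k km; rewrite mcoeffZ kill_outside_mnm; case: ifP => _.
  by rewrite mcoeffX (negPf km) mulr0.
by rewrite mcoeff0 mulr0.
Qed.

(** This is the ideal generated by the variables outside [C].  It is prime as
    the kernel of a ring morphism into an integral domain. *)
Lemma coord_prime C :
  is_prime_ideal (fun g => {in msupp g, forall m, ~~ (mnm_supp m \subset C)}).
Proof.
split.
- apply: (supp_ideal (P := fun m => ~~ (mnm_supp m \subset C))) => m m'.
  apply: contra; apply: subset_trans.
  by rewrite mnm_suppD subsetUr.
- move=> /(_ 0%MM); rewrite msupp1 inE eqxx => /(_ isT)/negP; apply.
  by apply/subsetP=> i; rewrite inE mnm0E.
- move=> f g /kill_outside_eq0; rewrite rmorphM => /eqP.
  rewrite mulf_eq0 => /orP[] /eqP /kill_outside_eq0; by [left | right].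
Qed.

End MonomialIdeals.

(** * Stable sets and witnesses of the v-number *)

Section EdgeIdeals.
Variables (K : fieldType) (n : nat) (G : sgraph 'I_n).
Local Open Scope ring_scope.
Implicit Types (f g : {mpoly K[n]}) (A C : {set 'I_n}).

Definition stable C := [forall i in C, forall j in C, ~~ adj G i j].

Definition nbhd A : {set 'I_n} := [set j | [exists i in A, adj G i j]].

Lemma stablePn C : reflect (exists i j, [/\ i \in C, j \in C & adj G i j])
  (~~ stable C).
Proof.
apply: (iffP idP) => [|[i [j [iC jC ij]]]].
  rewrite negb_forall => /existsP[i]; rewrite negb_imply negb_forall.
  case/andP=> iC /existsP[j]; rewrite negb_imply negbK => /andP[jC ij].
  by exists i, j.
by apply/negP=> /forall_inP/(_ i iC)/forall_inP/(_ j jC); rewrite ij.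
Qed.

Lemma stable_nadj C i j : stable C -> i \in C -> j \in C -> adj G i j = false.
Proof. by move=> /forall_inP/[apply]/forall_inP/[apply]/negbTE. Qed.

Lemma stableS A C : A \subset C -> stable C -> stable A.
Proof.
move=> /subsetP AC; apply: contraTT => /stablePn[i [j [iA jA ij]]].
by apply/stablePn; exists i, j; split=> //; apply: AC.
Qed.

(** A monomial is a multiple of some [X_i X_j] with [ij] an edge exactly when
    its support contains that edge. *)
Lemma edge_idealP f :
  edge_ideal G f <-> {in msupp f, forall m, ~~ stable (mnm_supp m)}.
Proof.
split.
  move: f; apply: (ideal_gen_sub
    (J := fun f => {in msupp f, forall m, ~~ stable (mnm_supp m)})) => [|_ [i [j [ij ->]]] m].
    apply: (supp_ideal K (P := fun m => ~~ stable (mnm_supp m))) => m m'.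
    apply: contra; apply: stableS.
    by rewrite mnm_suppD subsetUr.
  rewrite -mpolyXD msuppX inE => /eqP->; apply/stablePn; exists i, j.
  by rewrite mnm_suppD !mnm_supp1 !inE !eqxx orbT.
move=> fG; rewrite (mpolyE f).
have [_ _ IM] : is_ideal (@edge_ideal K n G) by apply: ideal_gen_ideal.
apply: ideal_sum; first exact: ideal_gen_ideal.
move=> m /fG/stablePn[i [j]]; rewrite !inE => -[mi mj ij].
have le_m : (U_(i) + U_(j) <= m)%MM.
  apply/mnm_lepP=> k; rewrite mnmDE !mnm1E.
  case: (eqVneq i k) => [<-|_]; last by case: eqVneq => // <-.
  case: (eqVneq j i) => // eji; move: ij; rewrite eji.
  by rewrite adj_irr.
rewrite -mul_mpolyC -(submK le_m) mpolyXD mulrA; apply: (IM).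
by apply: ideal_gen_mem; exists i, j; rewrite mpolyXD.
Qed.

(** The support of a monomial of [f] outside the edge ideal does the job: a
    variable lying in [(I : f)] must complete it to a multiple of an edge. *)
Lemma vnumber_at_stable d : vnumber_at (@edge_ideal K n G) d ->
  exists A, [/\ (#|A| <= d)%N, stable A & stable (~: nbhd A)].
Proof.
case=> f [p [/dhomogP fd [[_ p1 pP] _] fp]].
have /allPn[m mf stm] : ~~ all (fun m => ~~ stable (mnm_supp m)) (msupp f).
  apply/negP=> /allP If; apply: p1; apply/fp.
  by rewrite /colon mul1r; apply/edge_idealP.
rewrite negbK in stm; exists (mnm_supp m); split=> //.
  by rewrite -(fd m mf); apply: card_mnm_supp.
have pN i : p 'X_i -> i \in nbhd (mnm_supp m).
  move/fp/edge_idealP/(_ (U_(i) + m)%MM).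
  rewrite mulrC mcoeff_msupp mcoeffMX -mcoeff_msupp => /(_ mf)/stablePn.
  rewrite mnm_suppD mnm_supp1 => -[j [k [jm km jk]]].
  have adjN u v : u \in mnm_supp m -> adj G u v -> v \in nbhd (mnm_supp m).
    by move=> um uv; rewrite inE; apply/exists_inP; exists u.
  case/setU1P: jm => [ji|jm]; case/setU1P: km => [ki|km].
  - by move: jk; rewrite ji ki adj_irr.
  - by rewrite -ji; apply: (adjN k); rewrite // adj_sym.
  - by rewrite -ki; apply: (adjN j).
  - by rewrite (stable_nadj stm) in jk.
apply: contraT => /stablePn[i [j]]; rewrite !in_setC => -[iN jN ij].
have /pP[/pN iN'|/pN jN'] : p ('X_i * 'X_j); last by rewrite jN' in jN.
  apply/fp; rewrite /colon mulrC.
  have [_ _] : is_ideal (@edge_ideal K n G) by apply: ideal_gen_ideal.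
  by apply; apply: ideal_gen_mem; exists i, j.
by rewrite iN' in iN.
Qed.

(** Since [A] avoids [nbhd G A], multiplying a monomial by the product over [A]
    creates an edge in its support exactly when that support meets
    [nbhd G A]. *)
Lemma stable_vnumber_at A :
  stable A -> stable (~: nbhd A) -> vnumber_at (@edge_ideal K n G) #|A|.
Proof.
move=> stA stN; have AN : A \subset ~: nbhd A.
  apply/subsetP=> j jA; rewrite !inE; apply/exists_inP=> -[i iA].
  by rewrite (stable_nadj stA).
have colonE : ideal_eq
    (fun g => {in msupp g, forall m, ~~ (mnm_supp m \subset ~: nbhd A)})
    (colon (@edge_ideal K n G) 'X_[set_mnm A]).
  move=> g; rewrite /colon; split=> [gN|/edge_idealP gI m mg].
    apply/edge_idealP=> k; rewrite (perm_mem (msuppMX _ _)) => /mapP[m mg ->].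
    have /subsetPn[j jm] := gN m mg; rewrite in_setC negbK inE.
    case/exists_inP=> i iA ij; apply/stablePn; exists i, j.
    by rewrite mnm_suppD mnm_supp_set !in_setU iA jm orbT.
  have /gI : (set_mnm A + m)%MM \in msupp (g * 'X_[set_mnm A]).
    by rewrite mcoeff_msupp mcoeffMX -mcoeff_msupp.
  apply: contra => mN; apply: stableS stN.
  by rewrite mnm_suppD mnm_supp_set subUset AN.
exists 'X_[set_mnm A],
  (fun g => {in msupp g, forall m, ~~ (mnm_supp m \subset ~: nbhd A)}).
split; last by move=> g; split=> /colonE.
- by rewrite dhomogX; apply/eqP; apply: mdeg_set_mnm.
- by split; [apply: coord_prime | exists 'X_[set_mnm A]].
Qed.

End EdgeIdeals.

(** * Counting in the square of a path *)

Section PathSquare.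
Variable n : nat.
Local Notation G := (square (path_graph n)).
Implicit Types (i j a : 'I_n) (A C : {set 'I_n}).

Lemma square_pathE i j : adj G i j = [&& i != j, i <= j.+2 & j <= i.+2].
Proof.
rewrite /= /square_adj; case: (eqVneq i j) => //= ij.
apply/idP/idP => [/existsP[[k klt] /existsP[[p /= /eqP pk] /andP[]]]|].
  move=> + /eqP pj; rewrite -pj; move: klt; rewrite -pk.
  case: p pk pj => [|x [|y [|z p]]] //= _ _ _; rewrite /path_adj ?andbT; lia.
wlog le_ij : i j ij / i < j.
  move=> H; case: (ltngtP i j) => [lt_ij|lt_ji|/val_inj eij]; first exact: H.
    by move=> ?; rewrite dist_le_sym H // 1?eq_sym // andbC.
  by rewrite eij eqxx in ij.
case/andP=> _; rewrite leq_eqVlt => /orP[/eqP ji|ji].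
  have i1 : i.+1 < n by have := ltn_ord j; lia.
  apply/existsP; exists (@Ordinal 3 2 isT).
  apply/existsP; exists [tuple Ordinal i1; j].
  by rewrite /= /path_adj /= ji !eqxx.
apply/existsP; exists (@Ordinal 3 1 isT).
apply/existsP; exists [tuple j].
by rewrite /= /path_adj eqxx !andbT; apply/orP; left; lia.
Qed.

(** Any two vertices in a block of three consecutive ones are adjacent, and
    [(n + 2) %/ 3] blocks cover the path. *)
Lemma stable_square_path C : stable G C -> 3 * #|C| <= n + 2.
Proof.
move=> stC; suff: #|C| <= (n + 2) %/ 3 by lia.
have blk i : i %/ 3 < (n + 2) %/ 3 by have := ltn_ord i; lia.
rewrite -[leqRHS]card_ord -(card_in_imset (f := fun i => Ordinal (blk i))).
  exact: max_card.
move=> i j iC jC [eij]; apply/eqP; apply: contraFT (stable_nadj stC iC jC) => ij.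
by rewrite square_pathE ij; lia.
Qed.

(** A vertex and its neighbours lie in a window of five consecutive vertices. *)
Lemma nbhd_square_path1 a : #|[set j | adj G a j]| <= 4.
Proof.
suff: #|a |: [set j | adj G a j]| <= 5.
  by rewrite cardsU1 inE adj_irr.
rewrite -[leqRHS]card_ord.
rewrite -(card_in_imset (f := fun j => inord (j + 2 - a) : 'I_5)).
  exact: max_card.
move=> i j; rewrite !in_setU1 !inE !square_pathE -!val_eqE /= => iN jN.
move/(congr1 val); rewrite /= !inordK; [|lia..].
by move=> e; apply/val_inj => /=; lia.
Qed.

Lemma nbhd_square_path A : #|nbhd G A| <= 4 * #|A|.
Proof.
have -> : nbhd G A = \bigcup_(a in A) [set j | adj G a j].
  apply/setP=> j; rewrite inE; apply/exists_inP/bigcupP => -[i iA ij];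
  by exists i => //; rewrite inE in ij *.
rewrite mulnC -sum_nat_const.
apply: (big_ind2 (fun (B : {set 'I_n}) k => #|B| <= k)) => [|B k B' k' Bk Bk'|a _].
- by rewrite cards0.
- by apply: leq_trans (leq_card_setU _ _) (leq_add Bk Bk').
- exact: nbhd_square_path1.
Qed.

Lemma stable_nbhd_square_path A :
  stable G (~: nbhd G A) -> n <= 6 * #|A| + 1.
Proof.
move=> /stable_square_path stN; have := nbhd_square_path A.
have := cardsC (nbhd G A); rewrite card_ord; lia.
Qed.

End PathSquare.

(** * The edge ideal lies strictly below the maximal ideal *)

Section Proper.
Variables (K : fieldType) (n : nat) (G : sgraph 'I_n).

Lemma stable1 i : stable G [set i].
Proof.
by apply: contraT => /stablePn[j [k]]; rewrite !inE => -[/eqP-> /eqP->]; rewrite adj_irr.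
Qed.

Lemma edge_ideal_proper (i : 'I_n) :
  ideal_proper_sub (@edge_ideal K n G) (@maximal_graded_ideal K n).
Proof.
split=> [|mI].
  apply: ideal_gen_sub => [|_ [j [k [_ ->]]]]; first exact: ideal_gen_ideal.
  have [_ _] : is_ideal (@maximal_graded_ideal K n) by apply: ideal_gen_ideal.
  by apply; apply: ideal_gen_mem; exists k.
have /edge_idealP/(_ U_(i)%MM) : edge_ideal G ('X_i : {mpoly K[n]})%R.
  by apply/mI/ideal_gen_mem; exists i.
by rewrite msuppX inE eqxx mnm_supp1 stable1 => /(_ isT).
Qed.

End Proper.

(** Vertices spaced by 6 have disjoint neighbourhoods, which together cover
    everything but one residue class modulo 3, provided that all vertices near
    the two ends and outside that class are within distance 2 of the set. *)
Lemma square_path_witness (n : nat) (G := square (path_graph n)) :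
  exists A : {set 'I_n}, [/\ stable G A, stable G (~: nbhd G A) &
    #|A| = (n + 4) %/ 6].
Proof.
set v := (n + 4) %/ 6.
(* The first vertex [c], counted from 0, is 2 (so that 0 and 1 are its
   neighbours) unless the last vertices would then stay uncovered; the whole
   pattern is moved to the right for [n = 1] and to the left for [n = 2]
   modulo 6. *)
pose c := if n %% 6 == 1 then 3 else if n %% 6 == 2 then 1 else 2.
have lt_n (k : 'I_v) : 6 * k + c < n.
  by have := ltn_ord k; rewrite /v /c; do ?case: ifP; lia.
pose F (k : 'I_v) := Ordinal (lt_n k).
exists [set F k | k : 'I_v]; split.
- apply: contraT => /stablePn[_ [_ [/imsetP[k _ ->] /imsetP[l _ ->]]]].
  by rewrite square_pathE -val_eqE /=; lia.
- apply: contraT => /stablePn[i [j [iN jN]]].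
  (* Being congruent modulo 3, two vertices that are both missed by the
     neighbourhood are equal or at distance at least 3. *)
  have N3 (u : 'I_n) : u \in ~: nbhd G [set F k | k : 'I_v] -> u = c %[mod 3].
    rewrite in_setC inE => /exists_inPn uN.
    have hit (k : nat) : k < v ->
        ~~ [&& 6 * k + c != u, 6 * k + c <= u.+2 & u <= (6 * k + c).+2].
      move=> kv; have := uN (F (Ordinal kv)) (imset_f _ _).
      by rewrite square_pathE -val_eqE; apply.
    (* A vertex in another class is within distance 2 of [6 k + c] for a [k < v]
       that differs from [u %/ 6] by at most one. *)
    have := hit (u %/ 6).-1; have := hit (u %/ 6); have := hit (u %/ 6).+1.
    by have := ltn_ord u; rewrite /v /c; do ?case: ifP; lia.
  rewrite square_pathE -val_eqE /=; have := N3 i iN; have := N3 j jN; lia.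
- rewrite card_imset ?card_ord // => k l /(congr1 val) /= kl.
  by apply/val_inj => /=; lia.
Qed.

Theorem theorem4p2 (K : fieldType) (n : nat) (hn : 2 <= n) :
  is_vnumber (@edge_ideal K n (square (path_graph n)))
    (if (n == 0 %[mod 6]) || (n == 1 %[mod 6]) then n %/ 6 else n %/ 6 + 1).
Proof.
have -> : (if (n == 0 %[mod 6]) || (n == 1 %[mod 6]) then n %/ 6 else n %/ 6 + 1)
    = (n + 4) %/ 6.
  by case: ifP; lia.
right; split; first exact: edge_ideal_proper (Ordinal hn).
have [A [stA stN cA]] := square_path_witness n.
split; first lia.
  by rewrite -cA; apply: stable_vnumber_at.
move=> d _ /vnumber_at_stable[B [Bd _ BN]].
by have := stable_nbhd_square_path BN; lia.
Qed.
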